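(* Every coarsely discrete ballean $(X,\mathcal{E})$ is $\delta$-rigid.
   Context: A coarse structure on a set $X$ is a family $\mathcal{E}$ of subsets of $X\times X$ such that: each $E\in\mathcal{E}$ contains the diagonal $\triangle_X=\{(x,x):x\in X\}$; if $E,E'\in\mathcal{E}$ then $E\circ E'\in\mathcal{E}$ and $E^{-1}\in\mathcal{E}$, where $E\circ E'=\{(x,y):\exists z\,((x,z)\in E,\ (z,y)\in E')\}$ and $E^{-1}=\{(y,x):(x,y)\in E\}$; if $E\in\mathcal{E}$ and $\triangle_X\subseteq E'\subseteq E$ then $E'\in\mathcal{E}$; and $\bigcup\mathcal{E}=X\times X$. The pair $(X,\mathcal{E})$ is called a ballean (or coarse space). For $E\in\mathcal{E}$, $x\in X$, $A\subseteq X$: $E[x]=\{y\in X:(x,y)\in E\}$ and $E[A]=\bigcup_{a\in A}E[a]$. A subset $B\subseteq X$ is bounded if $B\subseteq E[x]$ for some $E\in\mathcal{E}$, $x\in X$. Subsets $A,B$ of $X$ are close, written $A\,\delta_{(X,\mathcal{E})}\,B$, if there is $E\in\mathcal{E}$ with $A\subseteq E[B]$ and $B\subseteq E[A]$. A ballean $(X,\mathcal{E})$ is $\delta$-rigid if for every coarse structure $\mathcal{E}'$ on $X$ with $\delta_{(X,\mathcal{E})}=\delta_{(X,\mathcal{E}')}$ we have $\mathcal{E}=\mathcal{E}'$. A ballean $(X,\mathcal{E})$ is discrete if for every $E\in\mathcal{E}$ there is a bounded subset $B$ such that $E[x]=\{x\}$ for each $x\in X\setminus B$. A subset $Y\subseteq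 X$ is discrete if the subballean $(Y,\mathcal{E}|_Y)$, $\mathcal{E}|_Y=\{E\cap(Y\times Y):E\in\mathcal{E}\}$, is discrete. A subset $Y\subseteq X$ is large if $X=E[Y]$ for some $E\in\mathcal{E}$. A ballean $(X,\mathcal{E})$ is coarsely discrete if $X$ contains a large discrete subset. *)

(* Defs.v *)
From mathcomp Require Import all_boot.
From mathcomp Require Import boolp classical_sets.

Local Open Scope classical_set_scope.

(* The library composition [F \; E] relates x to y when (x, z) \in E and
   (z, y) \in F for some z, so E o F is written [F \; E]. *)
Record coarse_structure {X : Type} (EE : set (set (X * X))) : Prop := {
  coarse_diagonal : forall E, EE E -> diagonal `<=` E;
  coarse_comp : forall E F, EE E -> EE F -> EE (F \; E)%relation;
  coarse_inv : forall E, EE E -> EE (E ^-1)%relation;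
  coarse_sub : forall E F, EE E -> diagonal `<=` F -> F `<=` E -> EE F;
  coarse_cover : \bigcup_(E in EE) E = [set: X * X]
}.

(* E[A]; the set E[x] is [xsection E x]. *)
Definition ball_around {X : Type} (E : set (X * X)) (A : set X) : set X :=
  \bigcup_(a in A) xsection E a.

Definition bounded_subset {X : Type} (EE : set (set (X * X))) (B : set X) :=
  exists E x, EE E /\ B `<=` xsection E x.

Definition close {X : Type} (EE : set (set (X * X))) (A B : set X) :=
  exists E, [/\ EE E, A `<=` ball_around E B & B `<=` ball_around E A].

Definition delta_rigid {X : Type} (EE : set (set (X * X))) :=
  forall EE', coarse_structure EE' -> close EE = close EE' -> EE = EE'.

Definition discrete_ballean {X : Type} (EE : set (set (X * X))) :=
  forall E, EE E ->
    exists B, bounded_subset EE B /\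
      forall x, (~` B) x -> xsection E x = [set x].

(* The subballean on Y lives on the subtype of elements of Y; pulling E back
   along the inclusion amounts to taking E `&` (Y `*` Y). *)
Definition subballean {X : Type} (EE : set (set (X * X))) (Y : set X) :
    set (set (Y * Y)) :=
  [set (fun p : Y * Y => (\val p.1, \val p.2)) @^-1` E | E in EE].

Definition discrete_subset {X : Type} (EE : set (set (X * X))) (Y : set X) :=
  discrete_ballean (subballean EE Y).

Definition large_subset {X : Type} (EE : set (set (X * X))) (Y : set X) :=
  exists E, EE E /\ [set: X] = ball_around E Y.

Definition coarsely_discrete {X : Type} (EE : set (set (X * X))) :=
  exists Y, large_subset EE Y /\ discrete_subset EE Y.

(* Main.v *)
Require Import Defs.
From mathcomp Require Import all_boot.
From mathcomp Require Import boolp classical_sets.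

Local Open Scope classical_set_scope.

(** Let [Y] be large and discrete for [EE], let [EE'] have the same close pairs, and let [r] move
    each point of X to a nearby point of [Y]. Given [E'] in [EE'], a family of pairs of [E'] whose
    first and second ends have disjoint [r]-images [A] and [B] makes [A] and [B] close disjoint
    subsets of [Y], hence bounded ([discrete_close_bounded]). If the family is maximal
    ([maximal_disjoint_images]), every pair of [E'] is either collapsed by [r] or has an end near
    [A] or [B], so [E'] lies in an entourage of [EE]. Thus [EE'] is contained in [EE]
    ([coarsely_discrete_finest]). This inclusion makes [EE'] coarsely discrete too
    ([coarsely_discrete_close_eq]), and exchanging the two structures gives equality. *)

Lemma maximal_disjoint_images {T U : Type} (D : set T) (f g : T -> U) :
  exists S, [/\ S `<=` D, f @` S `&` g @` S = set0 &
    forall d, D d ->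
      [\/ f d = g d, (f @` S `|` g @` S) (f d) |
          (f @` S `|` g @` S) (g d)]].
Proof.
(* The condition ranges over all [s] and [t], which is disjointness of the two images; it passes to
   the union of a chain because [s] and [t] lie in a common member. *)
pose P (S : set T) :=
  S `<=` D /\ forall s t, S s -> S t -> f s <> g t.
have [F FP Ftot|S [[SD Sdisj] Smax]] := @Zorn_bigcup T P.
  split=> [x [A /FP[AD _] /AD //]|s t [A FA As] [B FB Bt]].
  have [AB|BA] := Ftot _ _ FA FB.
    by have [_] := FP _ FB; apply => //; exact: AB.
  by have [_] := FP _ FA; apply => //; exact: BA.
exists S; split=> // [|d Dd].
  by apply/seteqP; split=> // y [[s Ss <-] [t St]] /esym /(Sdisj _ _ Ss St).
have [Sd|nSd] := pselect (S d); first by apply: Or32; left; exists d.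
have [//|fgd] := pselect (f d = g d); first exact: Or31.
have [|nf] := pselect ((f @` S `|` g @` S) (f d)); first exact: Or32.
have [|ng] := pselect ((f @` S `|` g @` S) (g d)); first exact: Or33.
(* If all three alternatives fail, [d] can be added to [S]: [f d <> g d] settles [d] against itself,
   the other two failures settle [d] against [S]. *)
case: (Smax (S `|` [set d])).
  by split=> [x Sx|/(_ d (or_intror erefl))//]; left.
split=> [x [/SD//|->//]|s t [Ss|->] [St|->]] //.
- exact: Sdisj.
- by move=> fg; apply: ng; left; exists s.
- by move=> fg; apply: nf; right; exists t.
Qed.

Lemma coarse_refl {X : Type} {EE : set (set (X * X))}
    (hE : coarse_structure EE) E x : EE E -> E (x, x).
Proof. by move=> EEE; apply: (coarse_diagonal _ hE _ EEE). Qed.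

Lemma coarse_pair {X : Type} {EE : set (set (X * X))}
    (hE : coarse_structure EE) p : exists2 E, EE E & E p.
Proof. by have : [set: X * X] p by []; rewrite -(coarse_cover _ hE). Qed.

(** Both factors lie in their composite because entourages contain the diagonal; this stands in for
    closure under unions. *)
Lemma coarse_join {X : Type} {EE : set (set (X * X))}
    (hE : coarse_structure EE) E F :
  EE E -> EE F -> exists2 G, EE G & E `|` F `<=` G.
Proof.
move=> EEE EEF; exists (F \; E)%relation; first exact: (coarse_comp _ hE).
by move=> [x y] [Exy|Fxy] /=; [exists y|exists x] => //;
  exact: (coarse_refl hE).
Qed.

Section Bounded.
Context {X : Type} {EE : set (set (X * X))}.
Hypothesis hE : coarse_structure EE.

Lemma bounded_ball_around E B :
  EE E -> bounded_subset EE B -> bounded_subset EE (ball_around E B).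
Proof.
move=> EEE [F [x [EEF BF]]]; exists (E \; F)%relation, x; split.
  exact: (coarse_comp _ hE).
move=> y [b /BF /xsectionP Fxb /xsectionP Eby].
by apply/xsectionP; exists b.
Qed.

Lemma bounded_subsetU A B :
  bounded_subset EE A -> bounded_subset EE B -> bounded_subset EE (A `|` B).
Proof.
move=> [E [x [EEE AE]]] [F [y [EEF BF]]].
have [G EEG Gxy] := coarse_pair hE (x, y).
have [H EEH GFH] := coarse_join hE _ _ EEE (coarse_comp _ hE _ _ EEG EEF).
exists H, x; split=> // z [/AE|/BF] /xsectionP Hz; apply/xsectionP/GFH.
  by left.
by right; exists y.
Qed.

Lemma bounded_square B :
  bounded_subset EE B -> exists2 E, EE E & B `*` B `<=` E.
Proof.
move=> [E [x [EEE BE]]]; exists (E \; E^-1)%relation.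
  by apply: (coarse_comp _ hE) => //; exact: (coarse_inv _ hE).
by move=> [a b] [/= /BE /xsectionP Exa /BE /xsectionP Exb]; exists x.
Qed.

Lemma close_sym A B : close EE A B -> close EE B A.
Proof. by move=> [E [EEE AB BA]]; exists E. Qed.

Lemma close_trans A B C : close EE A B -> close EE B C -> close EE A C.
Proof.
move=> [E [EEE AB BA]] [F [EEF BC CB]].
have [G EEG sG] := coarse_join hE _ _ (coarse_comp _ hE _ _ EEE EEF)
  (coarse_comp _ hE _ _ EEF EEE).
exists G; split=> // [a /AB [b /BC [c Cc Fcb] Eba]|
                       c /CB [b /BA [a Aa Eab] Fbc]].
  exists c => //; apply/xsectionP/sG; right.
  by exists b; apply/xsectionP.
exists a => //; apply/xsectionP/sG; left.
by exists b; apply/xsectionP.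
Qed.

Lemma close_images {T : Type} (S : set T) (f g : T -> X) E :
  EE E -> (forall t, S t -> E (f t, g t)) -> close EE (f @` S) (g @` S).
Proof.
move=> EEE fgE.
have [G EEG sG] := coarse_join hE _ _ EEE (coarse_inv _ hE _ EEE).
exists G; split=> // _ [t St <-].
  by exists (g t); [exists t|apply/xsectionP/sG; right; exact: fgE].
by exists (f t); [exists t|apply/xsectionP/sG; left; exact: fgE].
Qed.

(** If [a] in [A] lies in [E[b]] with [b] in [B], then [a <> b], so [E[b]] is not a singleton.
    Discreteness puts all such [b] in one bounded set [D], and [A] lies in [E[D]]. *)
Lemma discrete_close_bounded Y A B :
  discrete_subset EE Y -> A `<=` Y -> B `<=` Y -> A `&` B = set0 ->
  close EE A B -> bounded_subset EE A.
Proof.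
move=> Ydisc AY BY AB0 [E [EEE AB _]].
have [|D [[_ [y [[F EEF <-] DF]]] Dfix]] :=
    Ydisc ((fun p : Y * Y => (\val p.1, \val p.2)) @^-1` E); first by exists E.
exists (E \; F)%relation, (\val y); split; first exact: (coarse_comp _ hE).
move=> a Aa; have [b Bb /xsectionP Eba] := AB _ Aa.
have Ya := mem_set (AY _ Aa); have Yb := mem_set (BY _ Bb).
apply/xsectionP; exists b => //=.
have [/DF /xsectionP//|nD] := pselect (D (exist _ b Yb)).
have : [set exist (fun z => z \in Y) b Yb] (exist _ a Ya).
  by rewrite -Dfix //; apply/xsectionP.
move=> /(congr1 \val) /= ab; suff : (A `&` B) a by rewrite AB0.
by split; rewrite // ab.
Qed.

End Bounded.

Section SameCloseness.
Context {X : Type} {EE EE' : set (set (X * X))}.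
Hypotheses (hE : coarse_structure EE) (hE' : coarse_structure EE').
Hypothesis close_eq : close EE = close EE'.

(** A nonempty set is bounded exactly when it is close to a singleton, so closeness determines the
    bounded sets. *)
Lemma close_eq_bounded B : bounded_subset EE B -> bounded_subset EE' B.
Proof.
move=> Bbnd; have [->|/set0P[b Bb]] := eqVneq B set0.
  (* The empty set is close to no singleton; its boundedness only needs a point of X, taken here
     from [Bbnd]. *)
  have [_ [x _]] := Bbnd; have [E EEE _] := coarse_pair hE' (x, x).
  by exists E, x; split=> // ?.
have [E EEE BE] := bounded_square hE _ Bbnd.
have : close EE B [set b].
  exists E; split=> // [c Bc|_ ->].
    by exists b => //; apply/xsectionP/BE.
  by exists b => //; apply/xsectionP/BE.
rewrite close_eq => -[F [EEF BF _]]; exists F, b; split=> // c /BF.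
by case=> _ ->.
Qed.

End SameCloseness.

Section Rigidity.
Context {X : Type} {EE EE' : set (set (X * X))}.
Hypotheses (hE : coarse_structure EE) (hE' : coarse_structure EE').
Hypothesis close_eq : close EE = close EE'.

Lemma coarsely_discrete_finest : coarsely_discrete EE -> EE' `<=` EE.
Proof.
move=> [Y [[E [EEE XE]] Ydisc]] E' EE'E'.
have bnd := close_eq_bounded hE hE' close_eq.
have bnd' := close_eq_bounded hE' hE (esym close_eq).
have /choice[r rP] : forall x, exists y, Y y /\ E (y, x).
  move=> x; have : [set: X] x by [].
  by rewrite XE => -[y Yy /xsectionP Eyx]; exists y.
have rY x : Y (r x) by case: (rP x).
have rE x : E (r x, x) by case: (rP x).
have [S [SE' S0 Smax]] :=
  maximal_disjoint_images E' (fun p => r p.1) (fun p => r p.2).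
set A := (fun p => r p.1) @` S in S0 Smax.
set B := (fun p => r p.2) @` S in S0 Smax.
(* [A] and [B] are close to the sets of first and second coordinates of [S] through [E]; these two
   are close for [EE'] through [E'], hence for [EE]. *)
have AB : close EE A B.
  apply: (close_trans hE _ (fst @` S)).
    by apply: (close_images hE _ _ _ E).
  apply: (close_trans hE _ (snd @` S)).
    by rewrite close_eq; apply: (close_images hE' _ _ _ E') => // -[x y] /SE'.
  by apply/close_sym/(close_images hE _ _ _ E).
have AY : A `<=` Y by move=> _ [p _ <-].
have BY : B `<=` Y by move=> _ [p _ <-].
pose C := ball_around E (A `|` B).
have Cbnd : bounded_subset EE C.
  apply: (bounded_ball_around hE) => //; apply: (bounded_subsetU hE).
    exact: (discrete_close_bounded hE _ _ _ Ydisc AY BY).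
  apply: (discrete_close_bounded hE _ _ _ Ydisc BY AY); first by rewrite setIC.
  exact: close_sym.
(* [F] contains [E'] and its inverse, so whichever end of a pair of [E'] lies in [C], both ends lie
   in [F[C]]. *)
pose F := (E'^-1 \; E')%relation.
have EE'F : EE' F.
  by apply: (coarse_comp _ hE') => //; exact: (coarse_inv _ hE').
(* [F] is only known to belong to [EE']: boundedness of [C] is carried to [EE'], enlarged by [F]
   there, and carried back. *)
have [G EEG CG] : exists2 G, EE G & ball_around F C `*` ball_around F C `<=` G.
  by apply/(bounded_square hE)/bnd'/bounded_ball_around => //; exact: bnd.
have [H EEH sH] := coarse_join hE _ _ EEG
  (coarse_comp _ hE _ _ (coarse_inv _ hE _ EEE) EEE).
apply: (coarse_sub _ hE H) => //; first exact: (coarse_diagonal _ hE').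
have E'r := coarse_refl hE' _ _ EE'E'.
move=> [x y] E'xy; apply: sH.
case: (Smax _ E'xy) => /= [rxy|ABx|ABy]; [right|left; apply: CG..].
- by exists (r x) => /=; rewrite // rxy.
- have Cx : C x by exists (r x) => //; apply/xsectionP.
  by split; exists x => //; apply/xsectionP; [exists x|exists y].
- have Cy : C y by exists (r y) => //; apply/xsectionP.
  by split; exists y => //; apply/xsectionP; exists y.
Qed.

(** Largeness of [Y] says that [Y] is close to the whole of X, so closeness detects it. Discreteness
    descends to the subfamily [EE'] since the bounded sets are the same. *)
Lemma coarsely_discrete_close_eq : coarsely_discrete EE -> coarsely_discrete EE'.
Proof.
move=> EEdisc; have sub := coarsely_discrete_finest EEdisc.
case: EEdisc => Y [[E [EEE XE]] Ydisc]; exists Y; split.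
  have : close EE [set: X] Y.
    exists E; split=> //; first by rewrite -XE.
    by move=> y _; exists y => //; apply/xsectionP; exact: (coarse_refl hE).
  rewrite close_eq => -[F [EE'F XF _]]; exists F; split=> //.
  by apply/seteqP; split.
move=> _ [F EE'F <-].
have [|B [[_ [y [[G EEG <-] BG]]] Bfix]] :=
    Ydisc ((fun p : Y * Y => (\val p.1, \val p.2)) @^-1` F).
  by exists F => //; exact: sub.
exists B; split=> //.
(* As [y] itself lies in [G[y]], a square around [G[y]] puts this set inside [H[y]]; the centre thus
   remains a point of [Y], as the subballean requires. *)
have [|H EE'H GH] := bounded_square hE' (xsection G (\val y)).
  by apply: (close_eq_bounded hE hE' close_eq); exists G, (\val y); split.
exists ((fun p : Y * Y => (\val p.1, \val p.2)) @^-1` H), y.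
split; first by exists H.
move=> z /BG /xsectionP /= Gyz; apply/xsectionP/GH.
by split; apply/xsectionP => //=; exact: (coarse_refl hE).
Qed.

End Rigidity.

Theorem theorem4 (X : Type) (EE : set (set (X * X)))
    (hE : coarse_structure EE) (hD : coarsely_discrete EE) :
  delta_rigid EE.
Proof.
move=> EE' hE' close_eq; apply/seteqP; split; last first.
  exact: coarsely_discrete_finest hE hE' close_eq hD.
apply: (coarsely_discrete_finest hE' hE (esym close_eq)).
exact: coarsely_discrete_close_eq hE hE' close_eq hD.
Qed.
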